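(* Let $\mu>0$, $\mathcal{Q}>1$, let $x^*$ be the optimal solution of $$\min_{x_i\in\mathbb{R}^{\tilde n},\,i=1,\dots,m}\Big\{\Psi(x):=\sum_{i=1}^m\Big[f_i(x_i)+\frac\mu2\|x_i\|_2^2\Big]\Big\},\qquad f_i(x_i)=\frac{\mu(\mathcal{Q}-1)}4\Big[\frac12\langle Ax_i,x_i\rangle-\langle e_1,x_i\rangle\Big],$$ where $n=m\tilde n$, $x=(x_1,\dots,x_m)$, $A$ is the tridiagonal matrix given in the context, and denote $$q:=\frac{\sqrt{\mathcal{Q}}-1}{\sqrt{\mathcal{Q}}+1}.$$ Then the iterates $\{x^k\}$ generated by any randomized incremental gradient method must satisfy $$\frac{\mathbb{E}[\|x^k-x^*\|_2^2]}{\|x^0-x^*\|_2^2}\ge\frac12\exp\Big(-\frac{4k\sqrt{\mathcal{Q}}}{m(\sqrt{\mathcal{Q}}+1)^2-4\sqrt{\mathcal{Q}}}\Big)$$ for any $$n\ge\underline n(m,k)\equiv\frac{m\log\big[\big(1-(1-q^2)/m\big)^k/2\big]}{2\log q}.$$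
   Context: $\tilde n=n/m\in\{1,2,\dots\}$; $\|\cdot\|_2$ is the Euclidean norm; $e_1=(1,0,\dots,0)\in\mathbb{R}^{\tilde n}$; $A\in\mathbb{R}^{\tilde n\times\tilde n}$ is the symmetric tridiagonal matrix with all off-diagonal (sub/superdiagonal) entries $-1$, diagonal entries $2$ except the last diagonal entry, which is $\kappa=\frac{\sqrt{\mathcal{Q}}+3}{\sqrt{\mathcal{Q}}+1}$. Randomized incremental gradient method: a method that at iteration $t$ acquires the gradient of a randomly selected component function $f_{i_t}$ (viewed as a function of the full vector $x$ depending only on block $x_{i_t}$), where $i_1,i_2,\dots$ are independent random variables with $\mathrm{Prob}\{i_t=i\}=p_i$, $p_i\ge0$, $\sum_{i=1}^mp_i=1$, and that generates test points satisfying $x^k\in x^0+\mathrm{Lin}\{\nabla f_{i_1}(x^0),\dots,\nabla f_{i_k}(x^{k-1})\}$, where $\mathrm{Lin}$ denotes the linear span. The expectation is over $i_1,\dots,i_k$.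
   Formalization: The starting point is assumed to be x^0 = 0; for arbitrary x^0 the bound fails (m=1, x^0 = x^*+d with ∇f(x^0) = λd, λ≠0, admits x^1 = x^* ). *)

(* Defs.v *)
From HB Require Import structures.
From mathcomp Require Import all_boot all_order all_algebra.
From mathcomp Require Import all_classical all_reals all_analysis.
Import Order.TTheory GRing.Theory Num.Theory.
Import numFieldNormedType.Exports.

Set Implicit Arguments.
Unset Strict Implicit.
Unset Printing Implicit Defensive.

Local Open Scope classical_set_scope.
Local Open Scope ring_scope.

(* A point x = (x_1, ..., x_m) of (R^nt)^m is a matrix 'M[R]_(nt, m), whose
   i-th column is the block x_i. *)

(* The canonical norm `|x| on matrices is the sup norm. *)
Definition norm2 (R : realType) (a b : nat) (x : 'M[R]_(a, b)) : R :=
  Num.sqrt (\sum_(i < a) \sum_(j < b) x i j ^+ 2).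

Definition inner (R : realType) (a : nat) (u v : 'cV[R]_a) : R :=
  \sum_(i < a) u i 0 * v i 0.

Definition grad (R : realType) (a b : nat) (f : 'M[R]_(a, b) -> R)
    (x : 'M[R]_(a, b)) : 'M[R]_(a, b) :=
  \matrix_(i < a, j < b) 'D_(delta_mx i j) f x.

Definition e1 (R : realType) (nt : nat) : 'cV[R]_nt :=
  \col_(j < nt) ((j : nat) == 0)%:R.

Definition kappa (R : realType) (Q : R) : R :=
  (Num.sqrt Q + 3) / (Num.sqrt Q + 1).

(* Indices start at 0, so the last diagonal entry is the one with
   j.+1 = nt. *)
Definition tridiag (R : realType) (nt : nat) (Q : R) : 'M[R]_nt :=
  \matrix_(i < nt, j < nt)
    if i == j then (if j.+1 == nt then kappa Q else 2)
    else if (i.+1 == j :> nat) || (j.+1 == i :> nat) then -1 else 0.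

Definition block_fun (R : realType) (nt : nat) (mu Q : R) (y : 'cV[R]_nt) : R :=
  mu * (Q - 1) / 4
  * (2^-1 * inner (tridiag nt Q *m y) y - inner (e1 R nt) y).

Definition component (R : realType) (nt m : nat) (mu Q : R) (i : 'I_m)
    (x : 'M[R]_(nt, m)) : R :=
  block_fun mu Q (col i x).

Definition Psi (R : realType) (nt m : nat) (mu Q : R) (x : 'M[R]_(nt, m)) : R :=
  \sum_(i < m) (component mu Q i x + mu / 2 * norm2 (col i x) ^+ 2).

Definition is_optimal (T : Type) (R : realType) (F : T -> R) (xs : T) : Prop :=
  forall x, F xs <= F x.

(* Every subset of the value space U is taken as an event; this is meant for
   finite U with its discrete sigma-algebra. *)
Definition discrete_random (d : measure_display) (T : measurableType d)
    (U : Type) (X : T -> U) : Prop :=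
  forall B : set U, measurable (X @^-1` B).

Definition mutually_independent (R : realType) (d : measure_display)
    (T : measurableType d) (P : probability T R) (U : Type)
    (X : nat -> T -> U) : Prop :=
  forall (s : seq nat) (B : nat -> set U), uniq s ->
    P (\bigcap_(t in [set` s]) (X t @^-1` B t))
    = (\prod_(t <- s) P (X t @^-1` B t))%E.

(* idx t is the index drawn at iteration t + 1, so that x^k involves
   idx 0, ..., idx (k - 1). The test points x k are arbitrary random vectors:
   besides the drawn indices they may use internal randomness. *)
Record randomized_incremental_gradient (R : realType) (d : measure_display)
    (T : measurableType d) (P : probability T R) (nt m : nat)
    (f : 'I_m -> 'M[R]_(nt, m) -> R) (p : 'I_m -> R) (x0 : 'M[R]_(nt, m))
    (idx : nat -> T -> 'I_m) (x : nat -> T -> 'M[R]_(nt, m)) : Prop := {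
  rig_prob_ge0 : forall i, 0 <= p i;
  rig_prob_sum : \sum_(i < m) p i = 1;
  rig_idx_random : forall t, discrete_random (idx t);
  rig_idx_law : forall t i, P (idx t @^-1` [set i]) = (p i)%:E;
  rig_idx_indep : mutually_independent P idx;
  rig_point_random : forall k a b,
    measurable_fun [set: T] (fun w => x k w a b);
  rig_point_span : forall k w,
    x k w - x0 \in
      <<[seq grad (f (idx t w)) (x t w) | t <- iota 0 k]>>%VS }.

Definition rate (R : realType) (Q : R) : R :=
  (Num.sqrt Q - 1) / (Num.sqrt Q + 1).

Definition dim_bound (R : realType) (Q : R) (m k : nat) : R :=
  m%:R * ln ((1 - (1 - rate Q ^+ 2) / m%:R) ^+ k / 2) / (2 * ln (rate Q)).

(* Main.v *)
(** Every block of the minimizer is the geometric vector (q, q^2, ..., q^nt):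
    it solves the stationarity system, and A is positive semidefinite.
    Since A is tridiagonal, drawing component i reveals at most one new
    coordinate of block i, so after k steps block i vanishes from its N_i-th
    coordinate on, N_i being the number of draws of i. The squared error is
    therefore at least the sum over i of the geometric tails
    q^2 / (1 - q^2) * (q^(2 N_i) - q^(2 nt)). By independence
    E[q^(2 N_i)] = (1 - p_i (1 - q^2))^k, and by convexity the sum over i is
    smallest for uniform p. The bound on n makes the q^(2 nt) term cost at most
    half of the result, and 1 - u >= exp(- u / (1 - u)) gives the exponential. *)
Require Import Defs.
From HB Require Import structures.
From mathcomp Require Import all_boot all_order all_algebra.
From mathcomp Require Import ring lra.
From mathcomp Require Import all_classical all_reals all_analysis.
From mathcomp Require Import measurable_realfun.
Import Order.TTheory GRing.Theory Num.Theory.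
Import numFieldNormedType.Exports.

Local Open Scope classical_set_scope.
Local Open Scope ring_scope.

(** * Inner products and norms of blocks *)

Lemma inner_mx {R : realType} {nt} (u v : 'cV[R]_nt) : inner u v = (u^T *m v) 0 0.
Proof. by rewrite /inner mxE; apply: eq_bigr => i _; rewrite mxE. Qed.

Lemma innerDl {R : realType} {nt} (u v w : 'cV[R]_nt) :
  inner (u + v) w = inner u w + inner v w.
Proof. by rewrite !inner_mx linearD /= mulmxDl mxE. Qed.

Lemma innerDr {R : realType} {nt} (u v w : 'cV[R]_nt) :
  inner u (v + w) = inner u v + inner u w.
Proof. by rewrite !inner_mx mulmxDr mxE. Qed.

Lemma innerZl {R : realType} {nt} (a : R) (u v : 'cV[R]_nt) :
  inner (a *: u) v = a * inner u v.
Proof. by rewrite !inner_mx linearZ /= -scalemxAl mxE. Qed.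

Lemma innerZr {R : realType} {nt} (a : R) (u v : 'cV[R]_nt) :
  inner u (a *: v) = a * inner u v.
Proof. by rewrite !inner_mx -scalemxAr mxE. Qed.

Lemma innerC {R : realType} {nt} (u v : 'cV[R]_nt) : inner u v = inner v u.
Proof. by apply: eq_bigr => i _; rewrite mulrC. Qed.

Lemma norm2_sqr {R : realType} {a b} (x : 'M[R]_(a, b)) :
  norm2 x ^+ 2 = \sum_(i < a) \sum_(j < b) x i j ^+ 2.
Proof.
by rewrite /norm2 sqr_sqrtr//; do 2!apply: sumr_ge0 => ? _; exact: sqr_ge0.
Qed.

Lemma norm2_sqr_col {R : realType} {nt} (y : 'cV[R]_nt) :
  norm2 y ^+ 2 = inner y y.
Proof.
by rewrite norm2_sqr; apply: eq_bigr => i _; rewrite big_ord1 expr2.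
Qed.

(** * The tridiagonal matrix and its quadratic form *)

Lemma tridiag_sym {R : realType} {nt} (Q : R) (u v : 'cV[R]_nt) :
  inner (tridiag nt Q *m u) v = inner (tridiag nt Q *m v) u.
Proof.
have AT : (tridiag nt Q)^T = tridiag nt Q.
  apply/matrixP => i j; rewrite !mxE eq_sym.
  by case: eqVneq => [->//|_]; rewrite orbC.
by rewrite innerC !inner_mx trmx_mul AT mulmxA.
Qed.

Lemma block_funD {R : realType} {nt} (mu Q : R) (y h : 'cV[R]_nt) :
  block_fun mu Q (y + h) = block_fun mu Q y
  + mu * (Q - 1) / 4 * (inner (tridiag nt Q *m y) h - inner (e1 R nt) h)
  + mu * (Q - 1) / 4 * (2^-1 * inner (tridiag nt Q *m h) h).
Proof.
rewrite /block_fun mulmxDr !innerDl !innerDr (tridiag_sym Q h y).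
by field.
Qed.

(* [y] shifted by one and surrounded by zeros, so that the stencil of the
   tridiagonal matrix needs no case distinction at its ends. *)
Definition pad {R : realType} {nt} (y : 'cV[R]_nt) (a : nat) : R :=
  \sum_(j < nt) (j.+1 == a)%:R * y j 0.

Lemma pad0 {R : realType} {nt} (y : 'cV[R]_nt) : pad y 0 = 0.
Proof. by rewrite /pad big1// => j _; rewrite mul0r. Qed.

Lemma padS {R : realType} {nt} (y : 'cV[R]_nt) (j : 'I_nt) : pad y j.+1 = y j 0.
Proof.
rewrite /pad (bigD1 j)//= eqxx mul1r big1 ?addr0// => l lj.
by rewrite eqSS (negbTE (lj : val l != val j)) mul0r.
Qed.

Lemma pad_out {R : realType} {nt} (y : 'cV[R]_nt) : pad y nt.+1 = 0.
Proof.
rewrite /pad big1// => j _.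
by rewrite eqSS (ltn_eqF (ltn_ord j)) mul0r.
Qed.

Lemma tridiag_row {R : realType} {nt} (Q : R) (y : 'cV[R]_nt) (i : 'I_nt) :
  (tridiag nt Q *m y) i 0 =
  (if i.+1 == nt then kappa Q else 2) * y i 0 - pad y i.+2 - pad y i.
Proof.
rewrite -(padS y i) mxE /pad mulr_sumr -!sumrB; apply: eq_bigr => j _.
rewrite mxE !eqSS (eq_sym (j : nat) i.+1).
have -> : (j == i :> nat) = (i == j) by rewrite eq_sym.
case: (eqVneq i j) => [->|ij].
  by rewrite (gtn_eqF (ltnSn j)) !mul0r !subr0 mul1r.
case: (eqVneq i.+1 (j : nat)) => [<-|_] /=.
  rewrite (gtn_eqF (leqnSn i.+1)) /=; ring.
by case: eqP => _ /=; ring.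
Qed.

Lemma kappa_gt1 {R : realType} (Q : R) : 1 < kappa Q.
Proof.
rewrite /kappa ltr_pdivlMr; first by lra.
by have := sqrtr_ge0 Q; lra.
Qed.

(** Summation by parts: with all diagonal entries 2, the first k rows contribute a sum of squared
    differences plus the boundary term kept in [stencil]. Over all rows that term is the square of
    the last entry, and replacing 2 by [kappa Q] there leaves the factor [kappa Q - 1 > 0]. *)
Lemma tridiag_psd {R : realType} {nt} (Q : R) (y : 'cV[R]_nt) :
  0 <= inner (tridiag nt Q *m y) y.
Proof.
have stencil k : pad y k ^+ 2 - pad y k * pad y k.+1 <=
    \sum_(i < k) (2 * pad y i.+1 - pad y i.+2 - pad y i) * pad y i.+1.
  elim: k => [|k IH]; first by rewrite big_ord0 pad0; lra.
  rewrite big_ord_recr /=; have := sqr_ge0 (pad y k - pad y k.+1); nra.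
case: nt y stencil => [|n] y stencil; first by rewrite /inner big_ord0.
rewrite /inner big_ord_recr /= tridiag_row /= eqxx.
have := stencil n.+1; rewrite pad_out big_ord_recr /= (padS y ord_max).
have -> : \sum_(i < n) (2 * pad y i.+1 - pad y i.+2 - pad y i) * pad y i.+1 =
    \sum_(i < n) (tridiag n.+1 Q *m y) (widen_ord (leqnSn n) i) 0 *
                 y (widen_ord (leqnSn n) i) 0.
  apply: eq_bigr => i _; rewrite tridiag_row /= eqSS (ltn_eqF (ltn_ord i)).
  by rewrite -(padS y (widen_ord _ i)).
rewrite pad_out; have := kappa_gt1 Q; have := sqr_ge0 (y ord_max 0); nra.
Qed.

(** * The rate q and the geometric minimizer *)

Lemma rate_gt0 {R : realType} (Q : R) : 1 < Q -> 0 < rate Q.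
Proof.
move=> Q1; have s1 : 1 < Num.sqrt Q by rewrite -[1]sqrtr1 ltr_sqrt// (lt_trans _ Q1).
by rewrite /rate divr_gt0; lra.
Qed.

Lemma rate_lt1 {R : realType} (Q : R) : rate Q < 1.
Proof. by have := sqrtr_ge0 Q => ?; rewrite /rate ltr_pdivrMr; lra. Qed.

Definition geom {R : realType} (nt : nat) (Q : R) : 'cV[R]_nt :=
  \col_(j < nt) rate Q ^+ j.+1.

(** Interior rows hold because q is a root of q^2 - 2 (Q + 1) / (Q - 1) q + 1. In the first row [e1]
    supplies the missing neighbour q^0; in the last, kappa = 2 - q absorbs the missing neighbour
    q^(nt + 1). *)
Lemma geom_stationary {R : realType} (nt : nat) (mu Q : R) : 1 < Q ->
  (mu * (Q - 1) / 4) *: (tridiag nt Q *m geom nt Q - e1 R nt) +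
  mu *: geom nt Q = 0.
Proof.
move=> Q1; have s1 : 1 < Num.sqrt Q by rewrite -[1]sqrtr1 ltr_sqrt// (lt_trans _ Q1).
have sQ : Q = Num.sqrt Q ^+ 2 by rewrite sqr_sqrtr//; lra.
apply/matrixP => i j; rewrite ord1 {j}.
have := tridiag_row Q (geom nt Q) i.
move: (tridiag nt Q *m geom nt Q) => Ay Ayi; rewrite !mxE {}Ayi.
have padE : pad (geom nt Q) i + ((i : nat) == 0)%:R = rate Q ^+ i.
  case: i => -[|i] lt_i /=; first by rewrite pad0 add0r expr0.
  by rewrite (padS _ (Ordinal (ltnW lt_i))) mxE addr0.
have -> (a b c d : R) : a - b - c - d = a - b - (c + d) by ring.
rewrite padE !mxE.
case: eqP => [i_last|/eqP i_last].
  have -> : pad (geom nt Q) i.+2 = 0 by rewrite i_last pad_out.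
  rewrite /kappa exprS /rate {1}sQ.
  by field; lra.
have lt_i : (i.+1 < nt)%N by rewrite ltn_neqAle i_last ltn_ord.
rewrite (padS _ (Ordinal lt_i)) mxE /= !exprS /rate {1}sQ.
by field; lra.
Qed.

(** Each block objective is quadratic with curvature at least mu, so moving by h from the stationary
    point costs at least mu / 2 times the squared norm of h. Optimality of [xs] then forces h =
    0. *)
Lemma optimalE {R : realType} {nt m : nat} (mu Q : R) (xs : 'M[R]_(nt, m)) :
  0 < mu -> 1 < Q -> is_optimal (Psi mu Q) xs ->
  forall i j, xs i j = rate Q ^+ i.+1.
Proof.
move=> mu0 Q1 opt.
pose z : 'M[R]_(nt, m) := \matrix_(i, j) geom nt Q i 0.
have [h xsE] : exists h, xs = z + h by exists (xs - z); rewrite addrC subrK.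
have colz j : col j z = geom nt Q by apply/matrixP => a b; rewrite !mxE.
have growth j : component mu Q j z + mu / 2 * norm2 (col j z) ^+ 2 +
    mu / 2 * norm2 (col j h) ^+ 2 <=
    component mu Q j xs + mu / 2 * norm2 (col j xs) ^+ 2.
  rewrite /component xsE !linearD /= colz block_funD !norm2_sqr_col.
  have := congr1 (fun u => inner u (col j h)) (geom_stationary nt mu Q Q1).
  have -> : tridiag nt Q *m geom nt Q - e1 R nt =
    tridiag nt Q *m geom nt Q + (-1) *: e1 R nt by rewrite scaleN1r.
  rewrite innerDl !innerZl innerDl innerZl.
  have -> : inner 0 (col j h) = 0 :> R.
    by rewrite -(scale0r 0) innerZl mul0r.
  rewrite innerDl !innerDr (innerC (col j h) (geom nt Q)).
  have : 0 <= mu * (Q - 1) / 4 * (2^-1 * inner (tridiag nt Q *m col j h) (col j h)).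
    rewrite mulr_ge0 ?mulr_ge0 ?tridiag_psd//; lra.
  lra.
have : \sum_(j < m) norm2 (col j h) ^+ 2 = 0.
  apply/eqP; rewrite eq_le sumr_ge0 ?andbT; last by move=> *; exact: sqr_ge0.
  have := opt z; rewrite /Psi => /(le_trans (ler_sum _ (fun j _ => growth j))).
  rewrite big_split /= -mulr_sumr; nra.
move=> /eqP; rewrite psumr_eq0; last by move=> *; exact: sqr_ge0.
move=> /allP h0 i j; have /eqP := h0 j (mem_index_enum j).
move=> /eqP; rewrite norm2_sqr_col /inner psumr_eq0; last by move=> *; exact: sqr_ge0.
move=> /allP /(_ i (mem_index_enum i)).
by rewrite /= mulf_eq0 orbb mxE xsE => /eqP hij; rewrite !mxE hij addr0.
Qed.

(** * Gradients of the components and support of the iterates *)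

(** The difference quotient along [v] is exactly [L + h * M] for nonzero h. *)
Lemma derive_quadratic {R : realType} {a b : nat} (f : 'M[R]_(a, b) -> R)
    (v x : 'M[R]_(a, b)) (L M : R) :
  (forall h, f (x + h *: v) = f x + h * L + h ^+ 2 * M) -> 'D_v f x = L.
Proof.
move=> fE; apply: cvg_lim => //.
have : (L + h * M) @[h --> (0 : R)] --> L + 0 * M.
  by apply: cvgD; [exact: cvg_cst|apply: cvgMr_tmp; exact: cvg_id].
rewrite mul0r addr0 => /(cvg_within_filter (fun h => h != 0)).
apply: cvg_trans; apply: near_eq_cvg; near=> h.
have h0 : h != 0 by near: h; exact: nbhs_dnbhs_neq.
rewrite /= [_ *: v + _]addrC fE /GRing.scale /=; field.
exact: h0.
Unshelve. all: by end_near.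
Qed.

Lemma span_entry0 {R : realType} {m n : nat} (X : seq 'M[R]_(m, n))
    (v : 'M[R]_(m, n)) (a : 'I_m) (b : 'I_n) :
  (forall u, u \in X -> u a b = 0) -> v \in <<X>>%VS -> v a b = 0.
Proof.
move=> X0; rewrite -[X]/(tval (in_tuple X)) => /coord_span ->.
rewrite summxE big1// => i _; rewrite mxE X0 ?mulr0//.
by rewrite mem_nth.
Qed.

Lemma grad_component_col {R : realType} {nt m : nat} (mu Q : R) (i : 'I_m)
    (x : 'M[R]_(nt, m)) (a : 'I_nt) (b : 'I_m) :
  b != i -> grad (component mu Q i) x a b = 0.
Proof.
move=> bi; rewrite mxE; apply: (@derive_quadratic _ _ _ _ _ _ _ 0) => h.
rewrite !mulr0 !addr0 /component; congr block_fun.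
by apply/matrixP => r s; rewrite !mxE [i == b]eq_sym (negbTE bi) andbF mulr0 addr0.
Qed.

(** A has bandwidth one, so it extends the support of block i by at most one row. The strict [N < a]
    also makes a positive, where [e1] vanishes. *)
Lemma grad_component_row {R : realType} {nt m : nat} (mu Q : R) (i : 'I_m)
    (x : 'M[R]_(nt, m)) (N : nat) (a : 'I_nt) :
  (forall r : 'I_nt, (N <= r)%N -> x r i = 0) -> (N < a)%N ->
  grad (component mu Q i) x a i = 0.
Proof.
move=> x0 Na; rewrite mxE; set v : 'cV[R]_nt := delta_mx a 0.
apply: (@derive_quadratic _ _ _ _ _ _ _
  (mu * (Q - 1) / 4 * (2^-1 * inner (tridiag nt Q *m v) v))) => h.
have colE : col i (x + h *: delta_mx a i) = col i x + h *: v.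
  by apply/matrixP => r s; rewrite !mxE ord1 !eqxx.
rewrite /component colE block_funD -scalemxAr !innerZl !innerZr.
have -> : inner (tridiag nt Q *m col i x) v = 0.
  rewrite tridiag_sym /inner big1// => r _.
  have [Nr|rN] := leqP N r; first by rewrite [col i x r 0]mxE x0 ?mulr0.
  rewrite [X in X * _](_ : _ = 0) ?mul0r// mxE big1// => s _.
  rewrite !mxE; case: (eqVneq s a) => [->|]; last by rewrite mulr0.
  have ra : (r.+1 < a)%N by exact: leq_ltn_trans Na.
  have -> : (r == a) = false by apply: ltn_eqF; exact: ltnW.
  rewrite (ltn_eqF ra) gtn_eqF ?mul0r//.
  by rewrite ltnS; apply/ltnW/ltnW.
have -> : inner (e1 R nt) v = 0.
  rewrite /inner big1// => r _; rewrite !mxE.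
  by case: (eqVneq r a) => [->|]; rewrite ?mulr0// gtn_eqF ?mul0r// (leq_ltn_trans _ Na).
ring.
Qed.

Lemma iterate_support {R : realType} {nt m : nat} (mu Q : R)
    (i : nat -> 'I_m) (x : nat -> 'M[R]_(nt, m)) :
  (forall k, x k \in
     <<[seq grad (component mu Q (i t)) (x t) | t <- iota 0 k]>>%VS) ->
  forall k (a : 'I_nt) (b : 'I_m),
    (count (fun t => i t == b) (iota 0 k) <= a)%N -> x k a b = 0.
Proof.
move=> xspan; elim/ltn_ind => k IH a b ka.
apply: span_entry0 (xspan k) => _ /mapP[t tk ->].
move: tk; rewrite mem_iota add0n => /andP[_ tk].
have [ib|] := eqVneq b (i t); last exact: grad_component_col.
(* The draw at time t is counted up to k but not up to t, so the count at t is strictly below a. *)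
rewrite ib; apply: (grad_component_row _ _ _ _
  (count (fun s => i s == b) (iota 0 t))) => [r tr|].
  by apply: IH; rewrite -?ib.
apply: leq_trans ka; rewrite -(subnKC (ltnW tk)) iotaD count_cat.
have /prednK <- : (0 < k - t)%N by rewrite subn_gt0.
by rewrite /= ib eqxx addnS ltnS leq_addr.
Qed.

(** * Exponential moments of the draw counts *)

Lemma measurable_exp_count {R : realType} {d : measure_display}
    {T : measurableType d} {U : eqType} (X : nat -> T -> U) (i : U) (c : R)
    (s : seq nat) :
  (forall t, discrete_random (X t)) ->
  measurable_fun [set: T] (fun w => c ^+ count (fun t => X t w == i) s).
Proof.
move=> mX; elim: s => [|t s IH]; first exact: measurable_cst.
(* One draw contributes c to the power of an indicator, which is affine in that indicator. *)
have -> : (fun w => c ^+ count (fun t => X t w == i) (t :: s)) =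
    (fun w => (1 + (c - 1) * \1_(X t @^-1` [set i]) w) *
              c ^+ count (fun t => X t w == i) s).
  apply/funext => w; rewrite /= exprD indicE; congr (_ * _).
  have -> : (w \in X t @^-1` [set i]) = (X t w == i).
    by apply/idP/eqP => [/set_mem|?]; [|exact: mem_set].
  by case: eqP => _ /=; rewrite ?expr1 ?expr0; ring.
apply: measurable_funM => //; apply: measurable_funD; first exact: measurable_cst.
by apply: measurable_funM; [exact: measurable_cst|apply: measurable_indic; exact: mX].
Qed.

(* The event built from [s'] is what makes the induction on [s] go through:
   splitting on whether [X t] hits [i] moves [t] from [s] to [s']. *)
Lemma integral_exp_count {R : realType} {d : measure_display}
    {T : measurableType d} (P : probability T R) {U : eqType}
    (X : nat -> T -> U) (i : U) (p c : R) (s s' : seq nat) (B : nat -> set U) :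
  (forall t, discrete_random (X t)) -> mutually_independent P X ->
  (forall t, P (X t @^-1` [set i]) = p%:E) -> 0 <= c -> uniq (s ++ s') ->
  (\int[P]_(w in \bigcap_(t in [set` s']) (X t @^-1` B t))
     (c ^+ count (fun t => X t w == i) s)%:E =
   ((1 - p * (1 - c)) ^+ size s)%:E * \prod_(t <- s') P (X t @^-1` B t))%E.
Proof.
move=> mX indep law c0.
have mcap (r : seq nat) (C : nat -> set U) :
      measurable (\bigcap_(t in [set` r]) (X t @^-1` C t)).
  by apply: fin_bigcap_measurable => [|t _]; [exact: finite_seq|exact: mX].
have mexp r D : measurable_fun D
    (fun w => (c ^+ count (fun t => X t w == i) r)%:E).
  apply/measurable_EFinP; apply: (measurable_funS measurableT) => //.
  exact: measurable_exp_count.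
have expge0 r w : (0 <= (c ^+ count (fun t => X t w == i) r)%:E)%E.
  by rewrite lee_fin exprn_ge0.
elim: s s' B => [|t s IH] s' B /= us.
  by rewrite integral_cst// mul1e expr0 mul1e; exact: indep.
have /andP[tss' uss'] := us.
have [ts ts'] : t \notin s /\ t \notin s'.
  by move: tss'; rewrite mem_cat negb_or => /andP.
(* [B'] prescribes the event [D] for draw t and leaves all other draws as in [B]. *)
pose B' D u := if u == t then D else B u.
have B'E r D : t \notin r ->
    \big[setI/setT]_(u <- r) (X u @^-1` B' D u) =
    \big[setI/setT]_(u <- r) (X u @^-1` B u).
  move=> tr; apply: eq_big_seq => u ur; rewrite /B'.
  by case: eqP => // ut; move: tr; rewrite -ut ur.
have B'prod D : (\prod_(u <- t :: s') P (X u @^-1` B' D u) =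
    P (X t @^-1` D) * \prod_(u <- s') P (X u @^-1` B u))%E.
  rewrite big_cons {1}/B' eqxx; congr (_ * _)%E.
  apply: eq_big_seq => u us'; rewrite /B'.
  by case: eqP => // ut; move: ts'; rewrite -ut us'.
have split : \bigcap_(u in [set` s']) (X u @^-1` B u) =
    \bigcap_(u in [set` t :: s']) (X u @^-1` B' [set i] u) `|`
    \bigcap_(u in [set` t :: s']) (X u @^-1` B' (~` [set i]) u).
  rewrite !bigcap_seq !big_cons !B'E// /B' eqxx -setIUl.
  by rewrite -preimage_setC setUv setTI.
(* Where [X t] lies in [D], the factor contributed by draw t is the constant c^e and leaves the
   integral; the induction hypothesis handles the rest with t moved to the conditioning list. *)
have piece D (e : bool) : (forall u, D u -> (u == i) = e) ->
    (\int[P]_(w in \bigcap_(u in [set` t :: s']) (X u @^-1` B' D u))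
       (c ^+ ((X t w == i) + count (fun u => X u w == i) s))%:E =
     (c ^+ e * (1 - p * (1 - c)) ^+ size s)%:E *
     (P (X t @^-1` D) * \prod_(u <- s') P (X u @^-1` B u)))%E.
  move=> De; rewrite EFinM -muleA -B'prod -IH; last by rewrite -(cat1s t s') uniq_catCA.
  rewrite -ge0_integralZl//; last by rewrite lee_fin exprn_ge0.
  apply: eq_integral => w /set_mem /(_ t (mem_head _ _)).
  by rewrite /= {1}/B' eqxx => /De ->; rewrite exprD EFinM.
rewrite split ge0_integral_setU//; [|exact: (mexp (t :: s))|
  by move=> w _; exact: (expge0 (t :: s))|]; last first.
  apply/disj_setPS => w [h1 h2]; have tt : t \in t :: s' by rewrite mem_head.
  by have := h1 t tt; have := h2 t tt; rewrite /B' /= eqxx.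
rewrite (piece _ true) => [|u ->]; last by rewrite eqxx.
rewrite (piece _ false) => [|u /eqP/negbTE//].
rewrite -preimage_setC probability_setC ?law; last exact: mX.
(* The product is the probability of an event, hence finite, so what remains is the real identity p
   c + (1 - p) = 1 - p (1 - c). *)
have [r ->] : exists r, (\prod_(u <- s') P (X u @^-1` B u))%E = r%:E.
  exists (fine (P (\bigcap_(u in [set` s']) (X u @^-1` B u)))).
  rewrite fineK ?fin_num_measure//; symmetry; apply: indep.
  by move: uss'; rewrite cat_uniq => /and3P[].
rewrite -EFinB -!EFinM -EFinD expr1 expr0 exprS; congr EFin; ring.
Qed.

Lemma expectation_exp_count {R : realType} {d : measure_display}
    {T : measurableType d} (P : probability T R) {U : eqType}
    (X : nat -> T -> U) (i : U) (p c : R) (s : seq nat) :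
  (forall t, discrete_random (X t)) -> mutually_independent P X ->
  (forall t, P (X t @^-1` [set i]) = p%:E) -> 0 <= c -> uniq s ->
  (\int[P]_w (c ^+ count (fun t => X t w == i) s)%:E =
   ((1 - p * (1 - c)) ^+ size s)%:E)%E.
Proof.
move=> mX indep law c0 us.
have := @integral_exp_count R d T P U X i p c s [::] (fun=> setT).
rewrite bigcap_seq !big_nil cats0 mule1; exact.
Qed.

(** * Scalar inequalities *)

Lemma expr_ge_tangent {R : realFieldType} (x b : R) (k : nat) :
  0 <= x -> 0 <= b -> b ^+ k + k%:R * b ^+ k.-1 * (x - b) <= x ^+ k.
Proof.
move=> x0 b0; elim: k => [|[|k] IH].
- by rewrite !expr0; lra.
- by rewrite !expr1 expr0; lra.
have := ler_wpM2l x0 IH; rewrite [x * x ^+ _]mulrC -exprSr; apply: le_trans.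
(* This square is exactly the difference between x times the previous tangent and the new
   tangent. *)
have : 0 <= k.+1%:R * b ^+ k * (x - b) ^+ 2.
  by rewrite mulr_ge0 ?sqr_ge0// mulr_ge0 ?ler0n ?exprn_ge0.
rewrite /= !exprS -[k.+2%:R]natr1; nra.
Qed.

(** Jensen's inequality for the k-th power: in the sum of the tangents at the mean b, the linear
    terms cancel. *)
Lemma sum_expr_ge_mean {R : realFieldType} {m : nat} (y : 'I_m -> R) (b : R)
    (k : nat) :
  (forall i, 0 <= y i) -> 0 <= b -> \sum_(i < m) y i = m%:R * b ->
  m%:R * b ^+ k <= \sum_(i < m) y i ^+ k.
Proof.
move=> y0 b0 sumy.
apply: le_trans (ler_sum _ (fun i _ => expr_ge_tangent (y i) b k (y0 i) b0)).
rewrite big_split /= -mulr_sumr sumrB sumy !sumr_const card_ord.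
by rewrite -[b ^+ k *+ m]mulr_natl -[b *+ m]mulr_natl subrr mulr0 addr0.
Qed.

(** For N <= n this is the exact tail formula. For N > n the sum is empty and y^N <= y^n, so the
    additive form also covers blocks drawn more than n times. *)
Lemma geometric_tail_ge {R : realFieldType} (y : R) (n N : nat) :
  0 <= y -> y < 1 ->
  y / (1 - y) * y ^+ N <=
  \sum_(a < n | (N <= a)%N) y ^+ a.+1 + y / (1 - y) * y ^+ n.
Proof.
move=> y0 y1; have c0 : 0 <= y / (1 - y) by rewrite divr_ge0//; lra.
elim: n => [|n IH].
  by rewrite big_ord0 add0r ler_wpM2l// ler_wiXn2l// ltW.
have [Nn|nN] := leqP N n.
  rewrite big_mkcond big_ord_recr /= Nn -big_mkcond /=.
  apply: le_trans IH _; rewrite -addrA lerD2l exprS.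
  by rewrite le_eqVlt; apply/orP; left; apply/eqP; field; lra.
rewrite -[leLHS]add0r lerD ?sumr_ge0//; first by move=> *; exact: exprn_ge0.
by rewrite ler_wpM2l// ler_wiXn2l// ltW.
Qed.

Lemma geometric_sum {R : realFieldType} (y : R) (n : nat) : y < 1 ->
  \sum_(a < n) y ^+ a.+1 = y / (1 - y) * (1 - y ^+ n).
Proof.
move=> y1; elim: n => [|n IH]; first by rewrite big_ord0 expr0; ring.
by rewrite big_ord_recr /= IH !exprS; field; lra.
Qed.

(** Apply 1 + v <= exp v to v = u / (1 - u), where 1 + v = 1 / (1 - u), then invert. *)
Lemma expRN_le_pow1B {R : realType} (u : R) (k : nat) : u < 1 ->
  expR (- (k%:R * (u / (1 - u)))) <= (1 - u) ^+ k.
Proof.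
move=> u1; rewrite -mulrN expRM_natl lerXn2r ?nnegrE ?expR_ge0//; first lra.
have := expR_ge1Dx (u / (1 - u)).
have -> : 1 + u / (1 - u) = (1 - u)^-1 by field; lra.
rewrite expRN -[X in _ -> _ <= X]invrK lef_pV2 ?posrE ?expR_gt0 ?invr_gt0//; lra.
Qed.

(** * Distance to the minimizer and the dimension bound *)

(** Meant for one fixed outcome, with [N b] the number of draws of b: from row [N b] on the error is
    the minimizer's own entry, and earlier rows are bounded below by 0. *)
Lemma distance_ge {R : realType} {nt m : nat} (Q : R) (x xs : 'M[R]_(nt, m))
    (N : 'I_m -> nat) : 1 < Q ->
  (forall a b, xs a b = rate Q ^+ a.+1) ->
  (forall (a : 'I_nt) (b : 'I_m), (N b <= a)%N -> x a b = 0) ->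
  rate Q ^+ 2 / (1 - rate Q ^+ 2) * \sum_(b < m) (rate Q ^+ 2) ^+ N b <=
  norm2 (x - xs) ^+ 2 +
  m%:R * (rate Q ^+ 2 / (1 - rate Q ^+ 2) * (rate Q ^+ 2) ^+ nt).
Proof.
move=> Q1 xsE xN; have q0 := rate_gt0 Q Q1; have q1 := rate_lt1 Q.
have -> : m%:R * (rate Q ^+ 2 / (1 - rate Q ^+ 2) * (rate Q ^+ 2) ^+ nt) =
    \sum_(b < m) (rate Q ^+ 2 / (1 - rate Q ^+ 2) * (rate Q ^+ 2) ^+ nt).
  by rewrite sumr_const card_ord mulr_natl.
rewrite norm2_sqr exchange_big mulr_sumr -big_split /=.
apply: ler_sum => b _.
apply: le_trans (geometric_tail_ge _ nt _ _ _) _; [exact: sqr_ge0| |].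
  by rewrite expr_lt1// ltW.
rewrite lerD2r big_mkcond; apply: ler_sum => a _.
case: ifPn => [Na|_]; last exact: sqr_ge0.
by rewrite !mxE xN// xsE sub0r sqrrN exprAC.
Qed.

Lemma rate_gap {R : realType} (Q : R) :
  1 - rate Q ^+ 2 = 4 * Num.sqrt Q / (Num.sqrt Q + 1) ^+ 2.
Proof. by have := sqrtr_ge0 Q => ?; rewrite /rate; field; lra. Qed.

Lemma gap_over_lt1 {R : realType} (Q : R) (m : nat) : 1 < Q -> (0 < m)%N ->
  (1 - rate Q ^+ 2) / m%:R < 1.
Proof.
move=> Q1 m0; have q0 : 0 < rate Q ^+ 2 by rewrite exprn_gt0// rate_gt0.
rewrite ltr_pdivrMr ?ltr0n// mul1r; have : 1 <= m%:R :> R by rewrite ler1n.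
lra.
Qed.

(** Take logarithms: multiplying [dim_bound] through by 2 ln q < 0 reverses the inequality, and m
    cancels. *)
Lemma tail_le_half {R : realType} (Q : R) (m k nt : nat) :
  1 < Q -> (0 < m)%N -> dim_bound Q m k <= (m * nt)%:R ->
  (rate Q ^+ 2) ^+ nt <= (1 - (1 - rate Q ^+ 2) / m%:R) ^+ k / 2.
Proof.
move=> Q1 m0; rewrite /dim_bound.
have u1 := gap_over_lt1 Q m Q1 m0; have q0 := rate_gt0 Q Q1.
set A := (_ ^+ k / 2).
have A0 : 0 < A by rewrite divr_gt0// exprn_gt0// subr_gt0.
have lnq : ln (rate Q) < 0 by rewrite ln_lt0// q0 rate_lt1.
rewrite ler_ndivrMr; last lra.
rewrite natrM -mulrA ler_pM2l ?ltr0n// => dimA.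
rewrite -ler_ln ?posrE ?exprn_gt0//.
by rewrite lnXn ?exprn_gt0// lnXn// -mulr_natl -[ln _ *+ 2]mulr_natl.
Qed.

Theorem theorem3 (R : realType) (mu Q : R) (hmu : 0 < mu) (hQ : 1 < Q)
    (n m nt : nat) (hm : (0 < m)%N) (hnt : (0 < nt)%N) (hn : n = (m * nt)%N)
    (xstar : 'M[R]_(nt, m)) (hxstar : is_optimal (Psi mu Q) xstar)
    (d : measure_display) (T : measurableType d) (P : probability T R)
    (p : 'I_m -> R) (x0 : 'M[R]_(nt, m)) (hx0 : x0 = 0)
    (idx : nat -> T -> 'I_m) (x : nat -> T -> 'M[R]_(nt, m))
    (hx : randomized_incremental_gradient P (component mu Q) p x0 idx x)
    (k : nat) (hdim : dim_bound Q m k <= n%:R) :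
  ((1 / 2 * expR (- (4 * k%:R * Num.sqrt Q
        / (m%:R * (Num.sqrt Q + 1) ^+ 2 - 4 * Num.sqrt Q))))%:E
   <= 'E_P[fun w => (norm2 (x k w - xstar) ^+ 2)%R] / (norm2 (x0 - xstar) ^+ 2)%:E)%E.
Proof.
case: hx => p0 p1 mX law indep mx xspan.
have xsE := optimalE mu Q xstar hmu hQ hxstar.
have q0 := rate_gt0 Q hQ; have q1 := rate_lt1 Q.
have y1 : rate Q ^+ 2 < 1 by rewrite expr_lt1// ltW.
have y0 : 0 < rate Q ^+ 2 by rewrite exprn_gt0.
have u1 := gap_over_lt1 Q m hQ hm.
have AY : (rate Q ^+ 2) ^+ nt <= (1 - (1 - rate Q ^+ 2) / m%:R) ^+ k / 2.
  by apply: tail_le_half => //; rewrite -hn.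
have YB : 0 < (rate Q ^+ 2) ^+ nt < 1.
  by rewrite exprn_gt0// exprn_ilt1 ?ltW// -lt0n.
(* With u = (1 - q^2) / m, the quotient u / (1 - u) equals 4 sqrt Q / (m (sqrt Q + 1)^2 - 4 sqrt
   Q). *)
have exp_le : expR (- (4 * k%:R * Num.sqrt Q
    / (m%:R * (Num.sqrt Q + 1) ^+ 2 - 4 * Num.sqrt Q))) <=
    (1 - (1 - rate Q ^+ 2) / m%:R) ^+ k.
  apply: le_trans (expRN_le_pow1B _ k u1); rewrite ler_expR lerN2.
  have s0 := sqrtr_ge0 Q; have m0 : 0 < m%:R :> R by rewrite ltr0n.
  move: u1; rewrite rate_gap ltr_pdivrMr// mul1r => u1.
  have := u1; rewrite ltr_pdivrMr ?exprn_gt0//.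
  move=> u1'; rewrite le_eqVlt; apply/orP; left; apply/eqP; field.
  by apply/and3P; split; rewrite ?gt_eqF ?subr_gt0//; lra.
(* As the p_i sum to 1, the bases on the right have mean 1 - (1 - q^2) / m. *)
have meanE : m%:R * (1 - (1 - rate Q ^+ 2) / m%:R) ^+ k <=
    \sum_(i < m) (1 - p i * (1 - rate Q ^+ 2)) ^+ k.
  have p_le1 i : p i <= 1.
    by rewrite -p1 (bigD1 i)//= lerDl sumr_ge0.
  apply: sum_expr_ge_mean => [i||]; first 2 last.
  - rewrite sumrB -mulr_suml p1 sumr_const card_ord.
    by field; rewrite pnatr_eq0 -lt0n.
  - by have := p_le1 i; have := p0 i; nra.
  - lra.
have distE : norm2 (x0 - xstar) ^+ 2 =
    m%:R * (rate Q ^+ 2 / (1 - rate Q ^+ 2) * (1 - (rate Q ^+ 2) ^+ nt)).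
  rewrite norm2_sqr -geometric_sum// mulr_sumr; apply: eq_bigr => a _.
  rewrite (eq_bigr (fun=> (rate Q ^+ 2) ^+ a.+1)) => [|b _].
    by rewrite sumr_const card_ord mulr_natl.
  by rewrite hx0 sub0r !mxE xsE sqrrN exprAC.
have lower w : rate Q ^+ 2 / (1 - rate Q ^+ 2) *
    \sum_(b < m) (rate Q ^+ 2) ^+ count (fun t => idx t w == b) (iota 0 k) <=
    norm2 (x k w - xstar) ^+ 2 +
    m%:R * (rate Q ^+ 2 / (1 - rate Q ^+ 2) * (rate Q ^+ 2) ^+ nt).
  apply: distance_ge => // a b.
  apply: (iterate_support mu Q (idx^~ w) (x^~ w)) => j.
  by have := xspan j w; rewrite hx0 subr0.
have c0 : 0 < rate Q ^+ 2 / (1 - rate Q ^+ 2) by rewrite divr_gt0// subr_gt0.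
move: lower distE c0; set c := rate Q ^+ 2 / (1 - _); set y := rate Q ^+ 2.
move=> lower distE c0.
have mdist : measurable_fun [set: T] (fun w => norm2 (x k w - xstar) ^+ 2).
  under eq_fun => w do rewrite norm2_sqr.
  apply: measurable_sum => a; apply: measurable_sum => b.
  apply: measurable_funX; under eq_fun => w do rewrite !mxE.
  by apply: measurable_funD; [exact: mx|exact: measurable_cst].
(* With the tail term on the side of the expectation every integrand is nonnegative, so monotonicity
   and additivity of the integral hold even if the expectation is infinite. *)
have Elower : ((c * (m%:R * (1 - (1 - y) / m%:R) ^+ k))%:E <=
    'E_P[fun w => (norm2 (x k w - xstar) ^+ 2)%R] + (m%:R * (c * y ^+ nt))%:E)%E.
  apply: (@le_trans _ _ (\int[P]_w (c * \sum_(b < m)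
      y ^+ count (fun t => idx t w == b) (iota 0 k))%:E)%E).
    under eq_integral => w _ do rewrite EFinM -sumEFin.
    have mcount b : measurable_fun [set: T]
        (fun w => (y ^+ count (fun t => idx t w == b) (iota 0 k))%:E).
      by apply/measurable_EFinP; exact: measurable_exp_count.
    have count0 b w : (0 <= (y ^+ count (fun t => idx t w == b) (iota 0 k))%:E)%E.
      by rewrite lee_fin exprn_ge0// ltW.
    rewrite ge0_integralZl//; [|exact: emeasurable_sum|
      by move=> w _; exact: sume_ge0|by rewrite lee_fin ltW].
    rewrite ge0_integral_sum// (eq_bigr (fun b => ((1 - p b * (1 - y)) ^+ k)%:E)).
      by rewrite sumEFin -EFinM lee_fin ler_pM2l.
    move=> b _; rewrite (@expectation_exp_count _ _ _ P _ idx b (p b))//.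
    - by rewrite size_iota.
    - exact: ltW.
    - exact: iota_uniq.
  rewrite expectation.unlock.
  have -> : (m%:R * (c * y ^+ nt))%:E = (\int[P]_w (m%:R * (c * y ^+ nt))%:E)%E.
    rewrite integral_cst// -[LHS]mule1; congr (_ * _)%E.
    by apply: esym; exact: probability_setT.
  have my0 : 0 <= m%:R * (c * y ^+ nt).
    by rewrite mulr_ge0 ?ler0n// mulr_ge0 ?exprn_ge0// ltW.
  rewrite -ge0_integralD//; first last.
  - exact/measurable_EFinP.
  - by move=> w _; rewrite lee_fin sqr_ge0.
  apply: ge0_le_integral => //.
  - move=> w _; rewrite lee_fin mulr_ge0 ?(ltW c0)// sumr_ge0// => b _.
    by rewrite exprn_ge0// ltW.
  - apply/measurable_EFinP; apply: measurable_funM; first exact: measurable_cst.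
    by apply: measurable_sum => b; exact: measurable_exp_count.
  - apply/measurable_EFinP; apply: measurable_funD => //.
  - by move=> w _; rewrite -EFinD lee_fin.
have m0 : 0 < m%:R :> R by rewrite ltr0n.
(* Positivity rests on q^(2 nt) < 1, that is on nt > 0; it turns the extended division into a real
   one. *)
have D0 : 0 < norm2 (x0 - xstar) ^+ 2.
  by rewrite distE mulr_gt0// mulr_gt0// subr_gt0; case/andP: YB.
rewrite inver gt_eqF// lee_pdivlMr// -EFinM.
move: Elower; rewrite -leeBlDr// -EFinB; apply: le_trans.
rewrite lee_fin distE.
have mc0 : 0 <= m%:R * c by rewrite mulr_ge0// ltW.
have -> (z : R) : z * (m%:R * (c * (1 - y ^+ nt))) =
  m%:R * c * (z * (1 - y ^+ nt)) by ring.
set A := (1 - (1 - y) / m%:R) ^+ k in AY exp_le *.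
have -> : c * (m%:R * A) - m%:R * (c * y ^+ nt) = m%:R * c * (A - y ^+ nt) by ring.
apply: ler_wpM2l => //.
set e := expR _ in exp_le *; have e0 : 0 <= e by exact: expR_ge0.
(* With Y = q^(2 nt), e <= A and Y <= A / 2: A - Y >= A / 2 >= e / 2 >= e (1 - Y) / 2. *)
have /andP[Y0 _] := YB; have := mulr_ge0 e0 (ltW Y0); lra.
Qed.
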